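(* Let $E$ be a finite set and let $f: \{0,1\}^E \to \mathbb{R}$ be a monotone $1$-Lipschitz function. Let $\mathbf{p}\in[0,1]^E$, let $\mathbf{X}=\langle X_e\rangle_{e\in E}$ have independent coordinates $X_e\sim\mathrm{Ber}(p_e)$, and for $s\ge 0$ let $\mathbf{X}^{(s)}=\langle X^{(s)}_e\rangle_{e\in E}$ have independent coordinates $X^{(s)}_e\sim\mathrm{Ber}(e^{-s}p_e)$. Then for any $s \in (0,1]$ and $t > 0$: \[\Pr\left[f(\mathbf{X}^{(s)}) \geq \mathbb{E}[f(\mathbf{X})]+t\right] \leq e^{-st}.\]
   Context: $f$ is monotone if $f(\mathbf{x})\le f(\mathbf{y})$ whenever $\mathbf{x}\le\mathbf{y}$ coordinatewise, and $1$-Lipschitz if $|f(\mathbf{x})-f(\mathbf{y})|\le\|\mathbf{x}-\mathbf{y}\|_1$ for all $\mathbf{x},\mathbf{y}\in\{0,1\}^E$. *)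

(* Defs.v *)
From HB Require Import structures.
From mathcomp Require Import all_boot all_order all_algebra.
From mathcomp Require Import all_classical all_reals all_analysis.

Set Implicit Arguments.
Unset Strict Implicit.
Unset Printing Implicit Defensive.

Import Order.TTheory GRing.Theory Num.Theory.

Local Open Scope classical_set_scope.
Local Open Scope ring_scope.

(* Points of {0,1}^E are {ffun E -> bool}, with true = 1 and false = 0. *)

Definition cube_monotone (R : realType) (E : finType)
    (f : {ffun E -> bool} -> R) : Prop :=
  forall x y : {ffun E -> bool}, (forall e : E, (x e <= y e)%N) -> f x <= f y.

Definition cube_dist1 (R : realType) (E : finType)
    (x y : {ffun E -> bool}) : R :=
  \sum_(e : E) `|(x e)%:R - (y e)%:R|.

Definition cube_1Lipschitz (R : realType) (E : finType)
    (f : {ffun E -> bool} -> R) : Prop :=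
  forall x y : {ffun E -> bool}, `|f x - f y| <= cube_dist1 R x y.

Definition mutually_independent (d d' : measure_display)
    (T : measurableType d) (T' : measurableType d') (R : realType)
    (P : probability T R) (E : finType) (X : E -> {RV P >-> T'}) : Prop :=
  forall (J : {set E}) (A : E -> set T'),
    (forall e : E, measurable (A e)) ->
    P (\bigcap_(e in [set` J]) (X e @^-1` A e)) =
      (\prod_(e in J) P (X e @^-1` A e))%E.

Definition independent_bernoulli (d : measure_display) (T : measurableType d)
    (R : realType) (P : probability T R) (E : finType)
    (p : E -> R) (X : E -> {RV P >-> bool}) : Prop :=
  mutually_independent X /\
  forall e : E, distribution P (X e) =1 bernoulli_prob (p e).

Definition random_point (d : measure_display) (T : measurableType d)
    (R : realType) (P : probability T R) (E : finType)
    (X : E -> {RV P >-> bool}) (w : T) : {ffun E -> bool} :=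
  [ffun e => X e w].

(* Main.v *)
Require Import Defs.
From HB Require Import structures.
From mathcomp Require Import all_boot all_order all_algebra.
From mathcomp Require Import all_classical all_reals all_analysis.
From mathcomp Require Import ring lra.

(** Markov's inequality reduces the theorem to
    [E exp (s f(X^(s))) <= exp (s E f(X))].  For a single coordinate this
    follows from [1 + u <= exp u].  Averaging [f] over one coordinate of [X]
    keeps every discrete derivative in [[0, 1]], so the one-coordinate bound
    can be applied to the coordinates one after the other. *)

Import Order.TTheory GRing.Theory Num.Theory.

Local Open Scope classical_set_scope.
Local Open Scope ring_scope.

(** * Averaging functions on the cube, one coordinate at a time *)

Section Cube.
Context {R : realType} {E : finType}.
Implicit Types (f g : {ffun E -> bool} -> R) (p : E -> R).
Implicit Types (x y : {ffun E -> bool}) (e : E) (b : bool).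

Definition cube_set e b x : {ffun E -> bool} :=
  [ffun e' => if e' == e then b else x e'].

Definition bernoulli_weight p x : R :=
  \prod_(e : E) (if x e then p e else 1 - p e).

Definition cube_mean p f : R := \sum_x bernoulli_weight p x * f x.

(** The result stays a function on the whole cube, constant in coordinate [e], so that averagings
    can be iterated by [foldr]. *)
Definition coord_mean p e f x : R :=
  p e * f (cube_set e true x) + (1 - p e) * f (cube_set e false x).

Definition unit_increments f : Prop :=
  forall e x, 0 <= f (cube_set e true x) - f (cube_set e false x) <= 1.

Lemma cube_set_id e x : cube_set e (x e) x = x.
Proof. by apply/ffunP => e'; rewrite ffunE; case: eqP => // ->. Qed.

Lemma cube_set_set e b b' x : cube_set e b (cube_set e b' x) = cube_set e b x.
Proof. by apply/ffunP => e'; rewrite !ffunE; case: eqP. Qed.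

Lemma cube_setC e e' b b' x : e != e' ->
  cube_set e b (cube_set e' b' x) = cube_set e' b' (cube_set e b x).
Proof.
move=> ee'; apply/ffunP => i; rewrite !ffunE.
by have [->|//] := eqVneq i e; rewrite (negbTE ee').
Qed.

Lemma cube_dist1_set e x :
  cube_dist1 R (cube_set e true x) (cube_set e false x) = 1.
Proof.
rewrite /cube_dist1 (bigD1 e)//= !ffunE eqxx subr0 normr1 big1 ?addr0//.
by move=> i /negbTE ie; rewrite !ffunE ie subrr normr0.
Qed.

Lemma unit_increments_mono_lip f :
  cube_monotone f -> cube_1Lipschitz f -> unit_increments f.
Proof.
move=> fm fl e x; apply/andP; split.
  by rewrite subr_ge0; apply: fm => i; rewrite !ffunE; case: (i == e).
by apply: le_trans (ler_norm _) _; rewrite -[leRHS](cube_dist1_set e x); exact: fl.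
Qed.

(** In direction [e] the averaged function is constant; in any other direction updates commute, and
    its increment is a convex combination of two increments of [f]. *)
Lemma unit_increments_coord_mean p e f : 0 <= p e <= 1 ->
  unit_increments f -> unit_increments (coord_mean p e f).
Proof.
move=> /andP[p0 p1] fi i x; rewrite /coord_mean.
have [->|ie] := eqVneq i e; first by rewrite !cube_set_set subrr lexx ler01.
have ei : e != i by rewrite eq_sym.
rewrite !(@cube_setC e i)//.
have /andP[a0 a1] := fi i (cube_set e true x).
have /andP[b0 b1] := fi i (cube_set e false x).
by apply/andP; split; nra.
Qed.

(** [cube_set e false] maps the half [x e = true] bijectively onto the other half. *)
Lemma sum_cube_split e (h : {ffun E -> bool} -> R) :
  \sum_x h x = \sum_(x : {ffun E -> bool} | x e) (h x + h (cube_set e false x)).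
Proof.
rewrite (bigID (fun x : {ffun E -> bool} => x e))/= big_split/=; congr (_ + _).
rewrite (reindex_onto (cube_set e false) (cube_set e true)) /=; last first.
  by move=> x /negbTE xe; rewrite cube_set_set -xe cube_set_id.
apply: eq_bigl => x; rewrite cube_set_set ffunE eqxx/=.
by apply/eqP/idP => [<-|xe]; [rewrite ffunE eqxx | rewrite -xe cube_set_id].
Qed.

Lemma bernoulli_weight_set p e b x : bernoulli_weight p (cube_set e b x) =
  (if b then p e else 1 - p e) *
  \prod_(i | i != e) (if x i then p i else 1 - p i).
Proof.
rewrite /bernoulli_weight (bigD1 e)//= ffunE eqxx; congr (_ * _).
by apply: eq_bigr => i /negbTE ie; rewrite ffunE ie.
Qed.

(** The weights of two points differing only at [e] share the product over the other coordinates,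
    and [p e + (1 - p e) = 1]. *)
Lemma cube_mean_coord_mean p e f :
  cube_mean p (coord_mean p e f) = cube_mean p f.
Proof.
rewrite /cube_mean !(sum_cube_split e); apply: eq_bigr => x xe.
rewrite -[in bernoulli_weight p x](cube_set_id e x) xe !bernoulli_weight_set.
rewrite /coord_mean !cube_set_set.
have -> : cube_set e true x = x by rewrite -xe cube_set_id.
by ring.
Qed.

Lemma sum_bernoulli_weight p : \sum_x bernoulli_weight p x = 1.
Proof.
rewrite /bernoulli_weight.
(* The sum is the expansion of a product over [e] of factors [p e + (1 - p e)]. *)
rewrite -(bigA_distr_bigA (fun e b => if b then p e else 1 - p e)) big1// => e _.
by rewrite big_bool/= addrC subrK.
Qed.

Lemma bernoulli_weight_ge0 p x :
  (forall e, 0 <= p e <= 1) -> 0 <= bernoulli_weight p x.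
Proof.
move=> p01; apply: prodr_ge0 => e _; have /andP[p0 p1] := p01 e.
by case: ifP => // _; rewrite subr_ge0.
Qed.

Lemma le_cube_mean p f g : (forall e, 0 <= p e <= 1) ->
  (forall x, f x <= g x) -> cube_mean p f <= cube_mean p g.
Proof.
move=> p01 fg; apply: ler_sum => x _.
by rewrite ler_wpM2l// bernoulli_weight_ge0.
Qed.

Lemma cube_mean_cst p (c : R) : cube_mean p (fun=> c) = c.
Proof. by rewrite /cube_mean -mulr_suml sum_bernoulli_weight mul1r. Qed.

Lemma iter_coord_mean_eq p f (r : seq E) x y :
  (forall e, e \notin r -> x e = y e) ->
  foldr (coord_mean p) f r x = foldr (coord_mean p) f r y.
Proof.
elim: r x y => [|e r IHr] x y xy /=; first by congr f; apply/ffunP => e; exact: xy.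
rewrite /coord_mean; congr (_ * _ + _ * _); apply: IHr => i ir;
  by rewrite !ffunE; case: eqVneq => // ie; apply: xy; rewrite inE negb_or ie.
Qed.

(** Averaging over every coordinate leaves a constant, which equals its own mean, and no averaging
    changes the mean. *)
Lemma iter_coord_mean_enum p f x :
  foldr (coord_mean p) f (enum E) x = cube_mean p f.
Proof.
transitivity (cube_mean p (foldr (coord_mean p) f (enum E))).
  rewrite -[LHS](cube_mean_cst p); apply: eq_bigr => y _; congr (_ * _).
  by apply: iter_coord_mean_eq => e; rewrite mem_enum.
by elim: (enum E) => //= e r; rewrite cube_mean_coord_mean.
Qed.

(** * Exponential moments under thinning *)

Lemma expRN_mul_itv01 (s q : R) :
  0 <= s -> 0 <= q <= 1 -> 0 <= expR (- s) * q <= 1.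
Proof.
move=> s0 /andP[q0 q1]; rewrite mulr_ge0 ?expR_ge0//=.
by rewrite mulr_ile1 ?expR_ge0// expR_le1 oppr_le0.
Qed.

(** With [u = s * (a1 - a0)] and [expR (s * a0)] factored out, [1 + v <= expR v] reduces the claim
    to [expR (- s) * (expR u - 1) <= u]. *)
Lemma bernoulli_thinning_mgf (s q a0 a1 : R) :
    0 <= s -> 0 <= q -> 0 <= a1 - a0 <= 1 ->
  expR (- s) * q * expR (s * a1) + (1 - expR (- s) * q) * expR (s * a0) <=
    expR (s * (q * a1 + (1 - q) * a0)).
Proof.
move=> s0 q0 /andP[d0 d1]; set u := s * (a1 - a0).
have u0 : 0 <= u by rewrite mulr_ge0.
have us : u <= s by rewrite /u; nra.
have -> : s * a1 = s * a0 + u by rewrite /u; ring.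
have -> : s * (q * a1 + (1 - q) * a0) = s * a0 + q * u by rewrite /u; ring.
rewrite !expRD.
have -> : expR (- s) * q * (expR (s * a0) * expR u) +
    (1 - expR (- s) * q) * expR (s * a0) =
    expR (s * a0) * (1 + q * (expR (- s) * (expR u - 1))) by ring.
rewrite ler_wpM2l ?expR_ge0//.
apply: le_trans (expR_ge1Dx _) _; rewrite ler_expR ler_wpM2l//.
(* As [u <= s], [expR (- s)] may be raised to [expR (- u)]; the product is then [1 - expR (- u)], at
   most [u]. *)
have h1 : expR (- s) * (expR u - 1) <= expR (- u) * (expR u - 1).
  have u1 : 1 <= expR u by rewrite -expR0 ler_expR.
  by rewrite ler_wpM2r ?subr_ge0// ler_expR lerN2.
apply: le_trans h1 _; rewrite mulrBr mulr1 -expRD addNr expR0.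
by have := expR_ge1Dx (- u); lra.
Qed.

Lemma cube_thinning_mgf p f (s : R) : 0 <= s ->
    (forall e, 0 <= p e <= 1) -> unit_increments f ->
  cube_mean (fun e => expR (- s) * p e) (fun x => expR (s * f x)) <=
    expR (s * cube_mean p f).
Proof.
move=> s0 p01 fi; set q := fun e => _.
have q01 e : 0 <= q e <= 1 by exact: expRN_mul_itv01.
pose F r := foldr (coord_mean p) f r.
(* The outer law stays [q] while the exponent is averaged under [p]. Increments are carried along
   because the one-coordinate bound is applied to the function already averaged. *)
have [_ le_F] : unit_increments (F (enum E)) /\
    cube_mean q (fun x => expR (s * f x)) <=
    cube_mean q (fun x => expR (s * F (enum E) x)).
  elim: (enum E) => [|e r [Fi IHr]] //=; split.
    exact: unit_increments_coord_mean.
  (* Under [cube_mean q], an extra average over [e] costs nothing; the one-coordinate bound then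
     moves it into the exponent, with [p] in place of [q]. *)
  apply: le_trans IHr _; rewrite -(cube_mean_coord_mean q e).
  apply: le_cube_mean => // x; rewrite {1}/coord_mean /q.
  by have /andP[p0 _] := p01 e; exact: bernoulli_thinning_mgf.
apply: le_trans le_F _; rewrite -[leRHS](cube_mean_cst q).
by apply: le_cube_mean => // x; rewrite /F iter_coord_mean_enum.
Qed.

End Cube.

(** * From random variables to finite sums over the cube *)

Section RandomPoint.
Context {d : measure_display} {T : measurableType d} {R : realType}.
Context {P : probability T R} {E : finType}.
Variables (p : E -> R) (X : E -> {RV P >-> bool}).
Hypothesis p01 : forall e, 0 <= p e <= 1.
Hypothesis X_law : independent_bernoulli p X.

Lemma preimage_random_point x : random_point X @^-1` [set x] =
  \bigcap_(e in [set` [set: E]%SET]) (X e @^-1` [set x e]).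
Proof.
apply/seteqP; split=> w /=; first by move=> <- e _ /=; rewrite ffunE.
by move=> Xw; apply/ffunP => e; rewrite ffunE; apply: Xw => /=; rewrite finset.in_setT.
Qed.

Lemma measurable_random_point (A : set {ffun E -> bool}) :
  measurable (random_point X @^-1` A).
Proof.
have -> : random_point X @^-1` A = \bigcup_(x in A) (random_point X @^-1` [set x]).
  by apply/seteqP; split=> [w Aw|w [x Ax] /= ->//]; exists (random_point X w).
apply: fin_bigcup_measurable => [|x _]; first exact: finite_finset.
rewrite preimage_random_point; apply: fin_bigcap_measurable => [|e _].
  exact: finite_finset.
by rewrite -[_ @^-1` _]setTI; exact: measurable_funP.
Qed.

Lemma random_point_law x :
  P (random_point X @^-1` [set x]) = (bernoulli_weight p x)%:E.
Proof.
have [indepX bernX] := X_law.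
(* Independence is used with the full index set and singleton events. *)
rewrite preimage_random_point (indepX _ (fun e => [set x e]))// -prodEFin.
rewrite big_mkcond/=; apply: eq_bigr => e _; rewrite finset.in_setT.
have := bernX e [set x e]; rewrite /distribution/= /pushforward => ->.
rewrite bernoulli_probE// !diracE; case: (x e).
  by rewrite mem_set// memNset//= mule0 mule1 adde0.
by rewrite memNset// mem_set//= mule0 mule1 add0e.
Qed.

Lemma expectation_random_point (g : {ffun E -> bool} -> R) :
  ('E_P[fun w => g (random_point X w)] = (cube_mean p g)%:E)%E.
Proof.
have integrable_indicX x :
    P.-integrable [set: T] (EFin \o \1_(random_point X @^-1` [set x])).
  exact/integrable_indic/measurable_random_point.
(* The integrand is a finite linear combination of indicators of the fibres of [random_point X]. *)
rewrite unlock; under eq_integral => w _.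
  have -> : (g (random_point X w))%:E =
      (\sum_x (g x)%:E * (\1_(random_point X @^-1` [set x]) w)%:E)%E.
    rewrite (bigD1 (random_point X w))//= big1 => [|x xw].
      by rewrite indicE mem_set//= mule1 adde0.
    by rewrite indicE memNset ?mule0//= => /esym/eqP; exact/negP.
  over.
rewrite integral_sum//; last by move=> x; apply: integrableZl => //; exact: integrable_indicX.
rewrite /cube_mean -sumEFin; apply: eq_bigr => x _.
rewrite (integralZl measurableT (integrable_indicX x)) integral_indic//; last first.
  exact: measurable_random_point.
by rewrite setIT mulrC EFinM; congr (_ * _)%E; exact: random_point_law.
Qed.

End RandomPoint.

Theorem theorem1p3 (R : realType) (E : finType) (f : {ffun E -> bool} -> R)
    (f_mono : cube_monotone f) (f_lip : cube_1Lipschitz f)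
    (p : E -> R) (p01 : forall e : E, 0 <= p e <= 1)
    (d : measure_display) (T : measurableType d) (P : probability T R)
    (X : E -> {RV P >-> bool}) (X_law : independent_bernoulli p X)
    (s : R) (s_range : 0 < s <= 1)
    (d' : measure_display) (T' : measurableType d') (P' : probability T' R)
    (Xs : E -> {RV P' >-> bool})
    (Xs_law : independent_bernoulli (fun e : E => expR (- s) * p e) Xs)
    (t : R) (t_gt0 : 0 < t) :
  (P' [set w | 'E_P[fun v : T => f (random_point X v)] + t%:E
                 <= (f (random_point Xs w))%:E]
     <= (expR (- (s * t)))%:E)%E.

Proof.
have /andP[/ltW s0 _] := s_range.
have q01 e : 0 <= expR (- s) * p e <= 1 by exact: expRN_mul_itv01.
(* The two families may live on different probability spaces: only their laws enter, through
   [cube_mean]. *)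
rewrite (expectation_random_point _ _ p01 X_law) -EFinD.
set m := cube_mean p f; pose A := [set x | m + t <= f x].
rewrite (_ : [set w | _] = random_point Xs @^-1` A); last first.
  by apply/seteqP; split=> w /=; rewrite lee_fin.
rewrite -expectation_indic; last exact: measurable_random_point.
rewrite (_ : \1_ _ = fun w => \1_A (random_point Xs w) :> R); last first.
  by apply/funext => w; rewrite !indicE.
rewrite (expectation_random_point _ _ q01 Xs_law) lee_fin.
(* Markov's inequality in pointwise form: on [A] the total exponent [s * (f x - (m + t))] is
   nonnegative. *)
have markovA x : \1_A x <= expR (- (s * (m + t))) * expR (s * f x) :> R.
  rewrite -expRD indicE; have [/set_mem Ax|_] := boolP (x \in A); last exact: expR_ge0.
  rewrite -expR0 ler_expR addrC -mulrBr mulr_ge0// subr_ge0; exact: Ax.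
apply: le_trans (le_cube_mean _ _ _ q01 markovA) _.
have -> : cube_mean (fun e => expR (- s) * p e)
      (fun x => expR (- (s * (m + t))) * expR (s * f x)) =
    expR (- (s * (m + t))) *
      cube_mean (fun e => expR (- s) * p e) (fun x => expR (s * f x)).
  by rewrite /cube_mean mulr_sumr; apply: eq_bigr => x _; rewrite mulrCA.
(* This exposes the common factor [expR (- (s * (m + t)))], leaving exactly the exponential moment
   bound. *)
have -> : - (s * t) = - (s * (m + t)) + s * m by ring.
rewrite expRD ler_wpM2l ?expR_ge0//.
by apply: cube_thinning_mgf => //; exact: unit_increments_mono_lip.
Qed.
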